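(* Let $n\ge2$, $\eta>0$, $\mathbf p,\mathbf q\in\Delta_n$. Given $\tilde K\in\mathbb{R}_{>0}^{n\times n}$, let $\tilde C\in\mathbb{R}^{n\times n}$ be defined by $\tilde C_{ij}=-\eta^{-1}\log\tilde K_{ij}$. Let $D_1$ and $D_2$ be positive diagonal matrices such that $\tilde P:=D_1\tilde KD_2\in\Delta_{n\times n}$, and let $\delta:=\|\mathbf p-\tilde P\mathbf 1\|_1+\|\mathbf q-\tilde P^\top\mathbf 1\|_1$. If $\delta\le1$, then $$|V_{\tilde C}(\Pi^{\mathcal S}(\tilde K))-V_{\tilde C}(\tilde P)|\le\delta\|\tilde C\|_\infty+\eta^{-1}\delta\log\frac{2n}{\delta}.$$
   Context: $\Delta_n=\{v\in\mathbb{R}^n_{\ge0}:\sum_iv_i=1\}$, $\Delta_{n\times n}=\{P\in\mathbb{R}^{n\times n}_{\ge0}:\sum_{ij}P_{ij}=1\}$. $\mathcal M(\mathbf p,\mathbf q)=\{P\in\mathbb{R}_{\ge0}^{n\times n}:P\mathbf 1=\mathbf p,\ P^\top\mathbf 1=\mathbf q\}$, $\mathbf 1$ the all-ones vector. $H(P)=\sum_{ij}P_{ij}\log\frac1{P_{ij}}$ (with $0\log\frac10=0$) and $V_M(P)=\langle M,P\rangle-\eta^{-1}H(P)$. The Sinkhorn projection $\Pi^{\mathcal S}(K)=\Pi^{\mathcal S}_{\mathcal M(\mathbf p,\mathbf q)}(K)$ of an entrywise positive $K$ is the unique matrix in $\mathcal M(\mathbf p,\mathbf q)$ of the form $E_1KE_2$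 with $E_1,E_2$ positive diagonal; by a classical result (Wilson 1969) it equals $\arg\min_{P\in\mathcal M(\mathbf p,\mathbf q)}\langle-\log K,P\rangle-H(P)$ (entrywise log), which is taken as the definition when $\mathbf p$ or $\mathbf q$ has zero entries. $\|A\|_\infty=\max_{ij}|A_{ij}|$. The right-hand side is read as $0$ when $\delta=0$. *)

(* Defs.v *)
From mathcomp Require Import all_boot all_order all_algebra.
From mathcomp Require Import all_classical all_reals all_analysis.

Set Implicit Arguments.
Unset Strict Implicit.
Unset Printing Implicit Defensive.

Import Order.TTheory GRing.Theory Num.Theory.
Import numFieldNormedType.Exports.

Local Open Scope classical_set_scope.
Local Open Scope ring_scope.

(* Vectors of R^n are column vectors ('cV[R]_n), i.e. n x 1 matrices, so the
   simplex of column vectors is the case k = 1 and that of square matrices the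
   case k = n. *)
Definition simplex (R : realType) (n k : nat) : set 'M[R]_(n, k) :=
  [set A | A \is a mxOver Num.nneg /\ \sum_i \sum_j A i j = 1].

Definition transport_polytope (R : realType) (n : nat) (p q : 'cV[R]_n) :
    set 'M[R]_n :=
  [set P | [/\ P \is a mxOver Num.nneg,
               P *m const_mx 1 = p & P^T *m const_mx 1 = q]].

Definition frob_inner (R : realType) (n : nat) (A B : 'M[R]_n) : R :=
  \sum_i \sum_j A i j * B i j.

Definition norm1 (R : realType) (n : nat) (v : 'cV[R]_n) : R :=
  \sum_i `|v i ord0|.

(* A zero entry contributes 0 * ln 0^-1 = 0, as required. *)
Definition entropy (R : realType) (n : nat) (P : 'M[R]_n) : R :=
  \sum_i \sum_j P i j * ln (P i j)^-1.

Definition reg_cost (R : realType) (n : nat) (eta : R) (M P : 'M[R]_n) : R :=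
  frob_inner M P - eta^-1 * entropy P.

Definition is_scaling_of (R : realType) (n : nat) (K P : 'M[R]_n) : Prop :=
  exists e1 e2 : 'rV[R]_n,
    [/\ e1 \is a mxOver Num.pos, e2 \is a mxOver Num.pos
      & P = diag_mx e1 *m K *m diag_mx e2].

Definition is_argmin (T : Type) (R : realType) (A : set T) (f : T -> R) (x : T) :
    Prop :=
  A x /\ forall y, A y -> f x <= f y.

(* When p or q has a zero entry, no scaling of a positive K by positive diagonal
   matrices has these marginals; the projection is then defined variationally. *)
Definition is_sinkhorn_projection (R : realType) (n : nat) (p q : 'cV[R]_n)
    (K P : 'M[R]_n) : Prop :=
  if (p \is a mxOver Num.pos) && (q \is a mxOver Num.pos)
  then transport_polytope p q P /\ is_scaling_of K P
  else is_argmin (transport_polytope p q)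
         (fun Q => frob_inner (- map_mx (@ln R) K) Q - entropy Q) P.

(* For K entrywise positive and p, q in the simplex there is exactly one matrix
   satisfying [is_sinkhorn_projection p q K], so the default value 0 of [xget]
   is never used. *)
Definition sinkhorn_projection (R : realType) (n : nat) (p q : 'cV[R]_n)
    (K : 'M[R]_n) : 'M[R]_n :=
  xget 0 [set P | is_sinkhorn_projection p q K P].

(* Main.v *)
Require Import Defs.
From mathcomp Require Import all_boot all_order all_algebra.
From mathcomp Require Import all_classical all_reals all_analysis.
From mathcomp Require Import ring lra.

Set Implicit Arguments.
Unset Strict Implicit.
Unset Printing Implicit Defensive.

Import Order.TTheory GRing.Theory Num.Theory.
Import numFieldNormedType.Exports.

Local Open Scope classical_set_scope.
Local Open Scope ring_scope.

(* Up to the factor [eta^-1], [reg_cost] is the objective whose minimizer over a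
   transport polytope is the Sinkhorn projection of [K], and any positive
   diagonal scaling of [K] minimizes it over the polytope of its own marginals.
   So both matrices compared are minimizers, over two polytopes whose marginals
   differ by [delta]. A coupling argument moves any matrix of one polytope into
   the other at l1 cost at most [delta]; comparing each minimizer with the moved
   copy of the other one, it remains to bound the change of the cost under an l1
   perturbation of size [delta], which is Hoelder's inequality for the linear
   part and the Fannes inequality for the entropy.
   That the projection is a minimizer requires existence: a minimizer exists by
   compactness, and for positive marginals the first variation of the objective
   along 2x2 exchanges shows that it is a scaling of [K]. *)

(** * The entropy summand [- x ln x] and its elementary inequalities *)

Definition xlnV (R : realType) (x : R) : R := x * ln x^-1.

Section XlnV.
Variable R : realType.
Implicit Types x y m s t : R.

Lemma le_ln_tangent x y : 0 < x -> 0 < y -> ln x <= ln y + (x - y) / y.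
Proof.
move=> x0 y0; rewrite -lerBlDl -ln_div ?posrE//.
have -> : x / y = 1 + (x - y) / y by field; rewrite gt_eqF.
apply: le_ln1Dx; rewrite mulrBl divff ?gt_eqF//.
by have := divr_gt0 x0 y0; lra.
Qed.

Lemma xlnV0 : xlnV (0 : R) = 0.
Proof. by rewrite /xlnV mul0r. Qed.

Lemma xlnVE x : 0 <= x -> xlnV x = - (x * ln x).
Proof.
rewrite le_eqVlt => /predU1P[<-|x0]; first by rewrite xlnV0 mul0r oppr0.
by rewrite /xlnV lnV ?posrE// mulrN.
Qed.

Lemma xlnV_ge0 x : 0 <= x <= 1 -> 0 <= xlnV x.
Proof. by case/andP=> x0 x1; rewrite xlnVE// -mulrN mulr_ge0// oppr_ge0 ln_le0. Qed.

(** Concavity puts the graph below its tangent at [y]. This one bound serves the entropy estimate,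
    the minimality of scalings and the first variation. *)
Lemma xlnV_le_tangent x y : 0 <= x -> 0 < y -> xlnV x <= y - x - x * ln y.
Proof.
move=> + y0; rewrite le_eqVlt => /predU1P[<-|x0].
  by rewrite xlnV0 mul0r; lra.
have : x * ln y <= x * (ln x + (y - x) / x).
  by rewrite ler_pM2l// le_ln_tangent.
have -> : x * (ln x + (y - x) / x) = x * ln x + (y - x).
  by field; rewrite gt_eqF.
by rewrite (xlnVE (ltW x0)); lra.
Qed.

Lemma xlnV_subadd x y : 0 <= x -> 0 <= y -> xlnV (x + y) <= xlnV x + xlnV y.
Proof.
rewrite le_eqVlt => /predU1P[<-|x0]; first by rewrite xlnV0 !add0r.
rewrite le_eqVlt => /predU1P[<-|y0]; first by rewrite xlnV0 !addr0.
have xy0 := addr_gt0 x0 y0.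
rewrite !xlnVE ?[0 <= _]ltW// mulrDl opprD.
by apply: lerD; rewrite lerN2 ler_pM2l// ler_ln ?posrE//; lra.
Qed.

(* Log-sum inequality for [m + s], split with weights [1 - t] and [t]. *)
Lemma xlnV_add_ge m s t : 0 <= m -> 0 <= s <= t -> 0 < t < 1 ->
  xlnV m + m * ln (1 - t) <= xlnV (m + s).
Proof.
move=> m0 /andP[s0 st] /andP[t0 t1].
have := addr_ge0 m0 s0; rewrite le_eqVlt => /predU1P[ms0|ms0].
  have -> : m = 0 by lra.
  have -> : s = 0 by lra.
  by rewrite addr0 xlnV0 mul0r addr0.
have t'0 : 0 < 1 - t by lra.
(* Tangents at the shares [(1 - t) * (m + s)] and [t * (m + s)]: their affine parts cancel in the
   sum. The remaining term in [s] has a sign because [s <= t]. *)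
have := xlnV_le_tangent m0 (mulr_gt0 t'0 ms0).
have := xlnV_le_tangent s0 (mulr_gt0 t0 ms0).
rewrite !lnM ?posrE// (xlnVE (ltW ms0)).
have : 0 <= xlnV s + s * ln t.
  move: s0; rewrite le_eqVlt => /predU1P[<-|s0].
    by rewrite xlnV0 mul0r addr0.
  rewrite (xlnVE (ltW s0)) addrC -mulrBr mulr_ge0 ?(ltW s0)// subr_ge0 ler_ln ?posrE//.
by nra.
Qed.

(* Concavity of [ln] at [1 - t], the convex combination of [t] and [1] with
   weights [t / (1 - t)] and [1 - t / (1 - t)]. *)
Lemma xlnV_onem_le t : 0 < t <= 2^-1 -> xlnV (1 - t) <= xlnV t.
Proof.
move=> /andP[t0 th]; have b0 : 0 < 1 - t by lra.
rewrite (xlnVE (ltW t0)) (xlnVE (ltW b0)) lerN2.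
have h1 := le_ln_tangent t0 b0.
have := @le_ln_tangent 1 (1 - t) ltr01 b0; rewrite ln1 => h2.
have e : t * ((t - (1 - t)) / (1 - t)) + (1 - t - t) * ((1 - (1 - t)) / (1 - t)) = 0.
  by field; rewrite gt_eqF.
have := ler_wpM2l (ltW t0) h1.
have : 0 <= 1 - t - t by lra.
move=> /ler_wpM2l /(_ _ _ h2).
by nra.
Qed.

(* [t * ln (N / t)] increases up to [N / e], and [N / e > 1 / 2]. *)
Lemma mul_ln_div_mono (N s t : R) : 2 <= N -> 0 < s <= t -> t <= 2^-1 ->
  s * ln (N / s) <= t * ln (N / t).
Proof.
move=> N2 /andP[s0 st] th; have t0 : 0 < t by lra.
have N0 : 0 < N by lra.
have ln2 : 2^-1 <= ln (2 : R).
  by have := @le_ln_tangent 1 2 ltr01 (ltr0Sn R 1); rewrite ln1; lra.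
(* The slope [ln N - ln t - 1] at [t] is thus nonnegative, and the tangent at [t] bounds the value
   at [s]. *)
have lnN : 1 <= ln N - ln t.
  have : ln 2 <= ln N by rewrite ler_ln ?posrE.
  have : ln t <= ln 2^-1 by rewrite ler_ln ?posrE.
  by rewrite lnV ?posrE//; lra.
rewrite !ln_div ?posrE//.
have := xlnV_le_tangent (ltW s0) t0; rewrite (xlnVE (ltW s0)).
by nra.
Qed.

End XlnV.

(** * Entropy difference of two distributions in terms of their l1 distance *)

Section EntropyContinuity.
Variables (R : realType) (I : finType) (f g : I -> R).
Hypothesis f0 : forall i, 0 <= f i.
Hypothesis g0 : forall i, 0 <= g i.
Hypothesis f1 : \sum_i f i = 1.
Hypothesis g1 : \sum_i g i = 1.

(* Write [f = m + r] and [g = m + s] with [m] the pointwise minimum: removing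
   [r] costs at most its entropy, adding [s] loses at most [xlnV (1 - t)]. *)
Lemma sum_xlnV_sub (t : R) : 0 < t < 1 -> \sum_i `|f i - g i| = 2 * t ->
  \sum_i xlnV (f i) - \sum_i xlnV (g i)
    <= t * ln (#|I|%:R / t) + xlnV (1 - t).
Proof.
move=> t01 fgt; have /andP[t0 t1] := t01.
pose m i := Num.min (f i) (g i); pose r i := f i - m i; pose s i := g i - m i.
have mfg i : [/\ 0 <= m i, 0 <= r i, 0 <= s i & `|f i - g i| = r i + s i].
  rewrite /r /s /m; have := f0 i; have := g0 i; case: (leP (f i) (g i)) => fg gi fi.
    by rewrite ler0_norm ?subr_le0//; split; lra.
  by rewrite gtr0_norm ?subr_gt0//; split; lra.
have I0 : 0 < #|I|%:R :> R.
  rewrite ltr0n lt0n; apply: contra_eqN f1 => /eqP I0.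
  rewrite big_pred0 ?(eq_sym 0) ?oner_eq0// => i.
  by have := fintype0 i I0.
have rs : \sum_i r i = \sum_i s i.
  by rewrite !sumrB f1 g1.
have rt : \sum_i r i = t.
  move: fgt; rewrite (eq_bigr (fun i => r i + s i)); last by move=> i _; case: (mfg i).
  by rewrite big_split/= -rs; lra.
have st : \sum_i s i = t by rewrite -rs.
have mt : \sum_i m i = 1 - t.
  by rewrite -rt sumrB f1; lra.
(* The tangent is taken at [t / #|I|], the uniform distribution of mass [t], so [r] contributes at
   most [t * ln (#|I| / t)]. *)
have Hf : \sum_i xlnV (f i) <= \sum_i
    (xlnV (m i) + (t / #|I|%:R - r i - r i * ln (t / #|I|%:R))).
  apply: ler_sum => i _; have [mi ri si _] := mfg i.
  have -> : f i = m i + r i by rewrite /r; lra.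
  apply: (le_trans (xlnV_subadd mi ri)); rewrite lerD2l.
  by apply: xlnV_le_tangent => //; rewrite divr_gt0.
have Hg : \sum_i (xlnV (m i) + m i * ln (1 - t)) <= \sum_i xlnV (g i).
  apply: ler_sum => i _; have [mi ri si _] := mfg i.
  have -> : g i = m i + s i by rewrite /s; lra.
  apply: xlnV_add_ge => //; rewrite si/= -st (bigD1 i)//= lerDl sumr_ge0// => j _.
  by case: (mfg j).
move: Hf Hg; rewrite !big_split/= sumrN -!mulr_suml mt rt sumr_const.
rewrite !sumrN -!mulr_suml rt -[_ *+ _]mulr_natl.
have -> : #|I|%:R * t / #|I|%:R = t by field; rewrite gt_eqF.
rewrite [xlnV (1 - t)]xlnVE; last lra.
by rewrite !ln_div ?posrE//; lra.
Qed.

End EntropyContinuity.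

(* For [t] half the l1 distance, the Fannes bound [h(t) + t * ln #|I|], where [h]
   is the binary entropy, is at most [2 * t * ln (N / t)] as [t <= 1/2]. *)
Lemma dist_sum_xlnV (R : realType) (I : finType) (N : nat) (f g : I -> R) (d : R) :
  (2 <= N)%N -> (#|I| = N * N)%N ->
  (forall i, 0 <= f i) -> (forall i, 0 <= g i) ->
  \sum_i f i = 1 -> \sum_i g i = 1 ->
  \sum_i `|f i - g i| <= d -> d <= 1 ->
  \sum_i xlnV (f i) - \sum_i xlnV (g i) <= d * ln (2 * N%:R / d).
Proof.
move=> N2 IN f0 g0 f1 g1 fgd d1.
have N2R : 2 <= N%:R :> R by rewrite ler_nat.
set S : R := \sum_i _ in fgd *.
have S0 : 0 <= S by apply: sumr_ge0.
pose t := S / 2; have St : S = 2 * t by rewrite /t; lra.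
have : 0 <= t by lra.
rewrite le_eqVlt => /predU1P[t0|t0].
  have fg i : f i = g i.
    apply/eqP; rewrite -subr_eq0 -normr_eq0; apply/eqP.
    have S00 : S = 0 by lra.
    by apply: (psumr_eq0P _ S00) => // j _.
  under eq_bigr do rewrite fg.
  rewrite subrr; have : 0 <= d by lra.
  rewrite le_eqVlt => /predU1P[<-|d0]; first by rewrite mul0r.
  by rewrite mulr_ge0 ?(ltW d0)// ln_ge0// ler_pdivlMr//; lra.
have t01 : 0 < t < 1 by lra.
apply: (le_trans (sum_xlnV_sub f0 g0 f1 g1 t01 St)).
have th : 0 < t <= 2^-1 by lra.
have h : t * ln (#|I|%:R / t) + xlnV (1 - t) <= 2 * (t * ln (N%:R / t)).
  apply: (le_trans (lerD (lexx _) (xlnV_onem_le th))).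
  rewrite IN natrM (xlnVE (ltW t0)) !ln_div ?lnM ?posrE ?mulr_gt0//; [|lra..].
  by lra.
(* As [t <= d / 2 <= 1 / 2], the bound in [t] passes to [d / 2] by monotonicity. *)
have e : 2 * N%:R / d = N%:R / (d / 2) by field; rewrite gt_eqF//; lra.
have ->: d * ln (2 * N%:R / d) = 2 * (d / 2 * ln (N%:R / (d / 2))).
  by rewrite e; field.
apply: (le_trans h); rewrite ler_pM2l//.
by apply: mul_ln_div_mono => //; lra.
Qed.

(** * Transport polytopes: moving a coupling to other marginals *)

Section TransportPolytope.
Variables (R : realType) (n : nat).
Implicit Types (p q : 'cV[R]_n) (P Q : 'M[R]_n).

Lemma mulmx_const1E P i j : (P *m (const_mx 1 : 'cV_n)) i j = \sum_k P i k.
Proof. by rewrite mxE; apply: eq_bigr => k _; rewrite mxE mulr1. Qed.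

Lemma transport_polytopeP p q P :
  transport_polytope p q P <->
  [/\ forall i j, 0 <= P i j, forall i, \sum_j P i j = p i ord0
    & forall j, \sum_i P i j = q j ord0].
Proof.
split=> [[P0 Pp Pq]|[P0 Pp Pq]].
  split=> [i j|i|j]; first by have /mxOverP := P0; apply.
    by rewrite -Pp mulmx_const1E.
  by rewrite -Pq mulmx_const1E; apply: eq_bigr => i _; rewrite mxE.
split; first by apply/mxOverP => i j; exact: P0.
  by apply/colP => i; rewrite mulmx_const1E Pp.
by apply/colP => j; rewrite mulmx_const1E -Pq; apply: eq_bigr => i _; rewrite mxE.
Qed.

Lemma transport_polytope_tr p q P :
  transport_polytope p q P -> transport_polytope q p P^T.
Proof.
by case=> P0 Pp Pq; split; rewrite ?trmxK//; apply/mxOverP => i j;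
  rewrite mxE; have /mxOverP := P0; apply.
Qed.

Lemma simplexP (k : nat) (A : 'M[R]_(n, k)) :
  simplex A <-> (forall i j, 0 <= A i j) /\ \sum_i \sum_j A i j = 1.
Proof.
split=> -[A0 A1]; split=> //; last exact/mxOverP.
by move=> i j; have /mxOverP := A0; apply.
Qed.

Lemma simplex_cvP p :
  simplex p <-> (forall i, 0 <= p i ord0) /\ \sum_i p i ord0 = 1.
Proof.
rewrite simplexP; under eq_bigr do rewrite big_ord1.
by split=> -[p0 p1]; split=> // i j; rewrite ord1.
Qed.

Lemma transport_polytope_simplex p q P :
  simplex p -> transport_polytope p q P -> simplex P.
Proof.
move=> /simplex_cvP[_ p1] /transport_polytopeP[P0 Pp _]; apply/simplexP; split=> //.
by rewrite -p1; apply: eq_bigr => i _.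
Qed.

(* A fraction of each overfull row is removed; the removed mass is poured into
   the deficient rows with its own column profile, so that columns are kept. *)
Lemma transport_polytope_change_rows p p' q P :
  transport_polytope p q P -> (forall i, 0 <= p' i ord0) ->
  \sum_i p' i ord0 = \sum_i p i ord0 ->
  exists2 P', transport_polytope p' q P' &
    \sum_i \sum_j `|P' i j - P i j| <= norm1 (p' - p).
Proof.
move=> /[dup] PT /transport_polytopeP[P0 Pp Pq] p'0 pp'.
(* [b] is the deficit of each row and [l] its excess; their totals agree. *)
pose b i := Num.max 0 (p' i ord0 - p i ord0).
pose l i := Num.max 0 (p i ord0 - p' i ord0).
have p0 i : 0 <= p i ord0 by rewrite -Pp sumr_ge0.
have bl i : [/\ 0 <= b i, 0 <= l i, l i <= p i ord0, p' i ord0 = p i ord0 - l i + b i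
    & `|(p' - p) i ord0| = b i + l i].
  rewrite /b /l !mxE; have := p0 i; have := p'0 i.
  case: (leP (p i ord0) (p' i ord0)) => h u v.
    by rewrite ger0_norm ?subr_ge0// max_r ?subr_ge0// max_l ?subr_le0//; split; lra.
  rewrite ltr0_norm ?subr_lt0// max_l ?subr_le0 ?(ltW h)//.
  by rewrite max_r ?subr_ge0 ?(ltW h)//; split; lra.
have norm1E : norm1 (p' - p) = \sum_i b i + \sum_i l i.
  by rewrite -big_split; apply: eq_bigr => i _; case: (bl i).
pose t := \sum_i b i.
have lt : \sum_i l i = t.
  move: pp'; rewrite (eq_bigr (fun i => p i ord0 - l i + b i)); last first.
    by move=> i _; case: (bl i).
  by rewrite big_split sumrB/= -/t; lra.
have [t0|t0] := eqVneq t 0.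
  exists P.
    suff -> : p' = p by [].
    apply/colP => i; have [b0 l0 _ -> _] := bl i.
    have -> : b i = 0 by apply: (psumr_eq0P _ t0) => // k _; case: (bl k).
    have -> : l i = 0.
      by rewrite t0 in lt; apply: (psumr_eq0P _ lt) => // k _; case: (bl k).
    by rewrite subr0 addr0.
  rewrite norm1E lt -/t t0 addr0 big1// => i _.
  by rewrite big1// => j _; rewrite subrr normr0.
have {}t0 : 0 < t.
  by rewrite lt_def t0 sumr_ge0// => i _; case: (bl i).
(* Row [i] loses the fraction [l i / p i] of its mass. Where [p i] is zero the quotient is 0 by
   convention, and [l i] vanishes as well. *)
pose L i j := l i * (P i j / p i ord0).
have Pij i j : P i j <= p i ord0.
  by rewrite -Pp (bigD1 j)//= lerDl sumr_ge0.
have LP i j : 0 <= L i j <= P i j.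
  have [_ l0 lp _ _] := bl i; rewrite /L; apply/andP; split.
    by rewrite mulr_ge0// divr_ge0.
  have [pi0|pi0] := eqVneq (p i ord0) 0.
    by rewrite pi0 invr0 mulr0 mulr0.
  by rewrite mulrCA ler_piMr// ler_pdivrMr ?mul1r// lt_def pi0 p0.
have Ll i : \sum_j L i j = l i.
  rewrite -mulr_sumr -mulr_suml Pp.
  have [pi0|pi0] := eqVneq (p i ord0) 0.
    by have [_ l0 lp _ _] := bl i; rewrite pi0 mul0r; lra.
  by rewrite divff// mulr1.
pose c j := (\sum_k L k j) / t.
have c1 : \sum_j c j = 1.
  rewrite -mulr_suml exchange_big/= (eq_bigr l)// lt.
  by rewrite divff// gt_eqF.
have c0 j : 0 <= c j.
  by rewrite divr_ge0 ?(ltW t0)// sumr_ge0// => i _; case/andP: (LP i j).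
exists (\matrix_(i, j) (P i j - L i j + b i * c j)).
  apply/transport_polytopeP; split=> [i j|i|j].
  - rewrite mxE addr_ge0//; first by rewrite subr_ge0; case/andP: (LP i j).
    by rewrite mulr_ge0//; case: (bl i).
  - under eq_bigr do rewrite mxE.
    rewrite big_split sumrB/= Ll Pp -mulr_sumr c1 mulr1.
    by case: (bl i).
  - under eq_bigr do rewrite mxE.
    rewrite big_split sumrB/= Pq -[X in _ + X]mulr_suml -/t mulrC.
    by rewrite /c divfK ?gt_eqF// subrK.
rewrite norm1E.
have -> : \sum_i b i + \sum_i l i = \sum_i \sum_j (b i * c j + L i j).
  rewrite -big_split; apply: eq_bigr => i _.
  by rewrite big_split/= Ll -mulr_sumr c1 mulr1.
apply: ler_sum => i _; apply: ler_sum => j _.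
have -> : (\matrix_(i, j) (P i j - L i j + b i * c j)) i j - P i j
    = b i * c j - L i j by rewrite mxE; lra.
apply: (le_trans (ler_normB _ _)).
have [b0 _ _ _ _] := bl i; have /andP[L0 _] := LP i j.
by rewrite !ger0_norm// mulr_ge0.
Qed.

(** Rows are changed first, then columns as rows of the transpose. Each step keeps the other
    marginal, and the l1 costs add by the triangle inequality. *)
Lemma transport_polytope_change p p' q q' P :
  simplex p -> simplex q -> simplex p' -> simplex q' ->
  transport_polytope p q P ->
  exists2 P', transport_polytope p' q' P' &
    \sum_i \sum_j `|P' i j - P i j| <= norm1 (p' - p) + norm1 (q' - q).
Proof.
move=> /simplex_cvP[_ p1] /simplex_cvP[_ q1].
move=> /simplex_cvP[p'0 p'1] /simplex_cvP[q'0 q'1] PT.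
have pp' : \sum_i p' i ord0 = \sum_i p i ord0 by rewrite p1.
have qq' : \sum_i q' i ord0 = \sum_i q i ord0 by rewrite q1.
have [P1 /transport_polytope_tr P1T d1] := transport_polytope_change_rows PT p'0 pp'.
have [P2 P2T d2] := transport_polytope_change_rows P1T q'0 qq'.
exists P2^T; first exact: transport_polytope_tr.
apply: le_trans (lerD d1 d2); rewrite addrC [X in _ <= X + _]exchange_big -big_split/=.
apply: ler_sum => i _; rewrite -big_split; apply: ler_sum => j _ /=.
rewrite !mxE; apply: le_trans (ler_normD _ _).
by rewrite addrA subrK.
Qed.

End TransportPolytope.

(** * Minimizers of the Sinkhorn objective and diagonal scalings *)

Section SinkhornObjective.
Variables (R : realType) (n : nat).
Implicit Types (p q : 'cV[R]_n) (K P Q : 'M[R]_n).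

(** For positive [K] and nonnegative [Q] this is the sum of [Q ln (Q / K)], a relative entropy. *)
Definition sinkhorn_objective K Q : R :=
  frob_inner (- map_mx (@ln R) K) Q - entropy Q.

Lemma sinkhorn_objectiveE K Q :
  sinkhorn_objective K Q = \sum_i \sum_j (- (Q i j * ln (K i j)) - xlnV (Q i j)).
Proof.
rewrite /sinkhorn_objective /frob_inner /entropy -sumrB; apply: eq_bigr => i _.
by rewrite -sumrB; apply: eq_bigr => j _; rewrite !mxE mulNr [ln _ * _]mulrC.
Qed.

Lemma scalingE (d1 d2 : 'rV[R]_n) K i j :
  (diag_mx d1 *m K *m diag_mx d2) i j = d1 ord0 i * K i j * d2 ord0 j.
Proof. by rewrite mul_mx_diag mxE mul_diag_mx mxE. Qed.

(* Bounding each [xlnV (Q i j)] by its tangent at [P i j] bounds the objective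
   from below by a quantity that depends on [Q] only through its marginals. *)
Lemma scaling_argmin p q K P : K \is a mxOver Num.pos -> is_scaling_of K P ->
  transport_polytope p q P ->
  is_argmin (transport_polytope p q) (sinkhorn_objective K) P.
Proof.
move=> /mxOverP K0 [d1 [d2 [/mxOverP d10 /mxOverP d20 ->]]] PT; split=> // Q QT.
set P' := diag_mx d1 *m K *m diag_mx d2 in PT *.
have P'0 i j : 0 < P' i j.
  by have := K0 i j; have := d10 ord0 i; have := d20 ord0 j;
    rewrite scalingE !posrE => *; rewrite !mulr_gt0.
have lnP' i j : ln (P' i j) = ln (d1 ord0 i) + ln (K i j) + ln (d2 ord0 j).
  by rewrite scalingE !lnM// posrE mulr_gt0//; [exact: d10|exact: K0].
(* In the tangent bound at [P'] the terms [ln K] cancel: the objective at [Q] is at least [aff Q]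
   minus the mass of [P'], with equality at [Q = P']. *)
pose aff (S : 'M[R]_n) : R :=
  \sum_i \sum_j (S i j + S i j * ln (d1 ord0 i) + S i j * ln (d2 ord0 j)).
have affE S : transport_polytope p q S -> aff S = \sum_i p i ord0 +
    \sum_i p i ord0 * ln (d1 ord0 i) + \sum_j q j ord0 * ln (d2 ord0 j).
  move=> /transport_polytopeP[_ Sp Sq]; rewrite /aff.
  under eq_bigr do rewrite !big_split/= -mulr_suml Sp.
  rewrite !big_split/=; congr (_ + _); rewrite exchange_big/=.
  by apply: eq_bigr => j _; rewrite -mulr_suml Sq.
have affPQ : aff P' = aff Q by rewrite !affE.
have -> : sinkhorn_objective K P' = aff P' - \sum_i \sum_j P' i j.
  rewrite sinkhorn_objectiveE /aff -sumrB; apply: eq_bigr => i _.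
  rewrite -sumrB; apply: eq_bigr => j _.
  by rewrite (xlnVE (ltW (P'0 i j))) lnP'; lra.
rewrite affPQ sinkhorn_objectiveE /aff -sumrB; apply: ler_sum => i _.
rewrite -sumrB; apply: ler_sum => j _.
have /transport_polytopeP[Q0 _ _] := QT.
by have := xlnV_le_tangent (Q0 i j) (P'0 i j); rewrite lnP'; lra.
Qed.

Lemma sum_delta_mx (i j : 'I_n) (w : 'I_n -> 'I_n -> R) :
  \sum_a \sum_b (delta_mx i j : 'M[R]_n) a b * w a b = w i j.
Proof.
rewrite (bigD1 i)//= (bigD1 j)//= mxE !eqxx mul1r !big1 ?addr0//.
  by move=> a ai; rewrite big1// => b _; rewrite mxE (negPf ai) mul0r.
by move=> b bj; rewrite mxE (negPf bj) andbF mul0r.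
Qed.

(** The limit [t -> 0], made explicit: for [t <= 1] the two sides together move by at most [t * M],
    which cannot close a gap [d > t * M]. *)
Lemma mul_shift_limit (A B x y u v t0 : R) : 0 < A -> 0 < B -> 0 <= x -> 0 <= y ->
  0 < u -> 0 < v -> 0 < t0 ->
  (forall t, 0 < t < t0 -> B * ((u - t) * (v - t)) <= A * ((x + t) * (y + t))) ->
  B * (u * v) <= A * (x * y).
Proof.
move=> A0 B0 x0 y0 u0 v0 t00 H; rewrite leNgt; apply/negP => h.
pose d := B * (u * v) - A * (x * y).
pose M := A * (x + y + 1) + B * (u + v).
have d0 : 0 < d by rewrite subr_gt0.
have M0 : 0 < M by rewrite addr_gt0// mulr_gt0//; lra.
have [t [/andP[t_gt0 tt0] t1 tM]] : exists t, [/\ 0 < t < t0, t <= 1 & t * M < d].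
  exists (Num.min 1 (Num.min (t0 / 2) (d / (2 * M)))); split.
  - rewrite !lt_min gt_min ltr01 !divr_gt0 ?mulr_gt0//=.
    by apply/orP; right; rewrite gt_min; apply/orP; left; lra.
  - by rewrite ge_min lexx.
  - rewrite -ltr_pdivlMr//; rewrite gt_min; apply/orP; right.
    rewrite gt_min; apply/orP; right; rewrite ltr_pdivrMr ?mulr_gt0//.
    by rewrite [ltRHS](_ : _ = 2 * d); [lra|field; rewrite gt_eqF].
have := H t; rewrite t_gt0 tt0 => /(_ isT) Ht.
have e1 : A * (t * t) <= A * t by rewrite ler_pM2l// ler_piMr// ltW.
have e2 : 0 <= B * (t * t) by rewrite !mulr_ge0// ltW.
move: tM Ht e1 e2; rewrite /M /d; lra.
Qed.

(* First variation of the objective along the exchange cycle (i,j), (k,l). *)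
Lemma argmin_exchange_le p q K P i j k l : K \is a mxOver Num.pos ->
  is_argmin (transport_polytope p q) (sinkhorn_objective K) P ->
  i != k -> j != l ->
  K i j * K k l * (P i l * P k j) <= K i l * K k j * (P i j * P k l).
Proof.
move=> /mxOverP K0 [PT Pmin] ik jl.
have {}K0 a b : 0 < K a b by have := K0 a b.
have /transport_polytopeP[P0 Pp Pq] := PT.
(* If [P i l] or [P k j] is zero, the left side vanishes; otherwise a small mass [t] can be moved
   off both. *)
have := P0 i l; rewrite le_eqVlt => /predU1P[<-|il0].
  by rewrite mul0r mulr0 !mulr_ge0// ltW.
have := P0 k j; rewrite le_eqVlt => /predU1P[<-|kj0].
  by rewrite !mulr0 !mulr_ge0// ltW.
apply: (@mul_shift_limit _ _ _ _ _ _ (Num.min (P i l) (P k j))) => //.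
- by rewrite mulr_gt0.
- by rewrite mulr_gt0.
- by rewrite lt_min il0.
move=> t; rewrite lt_min => /and3P[t0 til tkj].
pose D : 'M[R]_n := delta_mx i j + delta_mx k l - delta_mx i l - delta_mx k j.
pose Q := P + t *: D.
have ki : (k == i) = false by rewrite eq_sym (negPf ik).
have lj : (l == j) = false by rewrite eq_sym (negPf jl).
have QE := (negPf ik, negPf jl, ki, lj, eqxx).
have Qij : Q i j = P i j + t by rewrite !mxE !QE/=; lra.
have Qkl : Q k l = P k l + t by rewrite !mxE !QE/=; lra.
have Qil : Q i l = P i l - t by rewrite !mxE !QE/=; lra.
have Qkj : Q k j = P k j - t by rewrite !mxE !QE/=; lra.
(* Touched entries of [Q] are positive even where [P] vanishes, so the tangent at [Q] is available
   there. *)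
have Q0 a b : 0 < Q a b \/ Q a b = P a b.
  have [[-> ->]|h1] := pselect (a = i /\ b = j).
    by left; rewrite Qij; have := P0 i j; lra.
  have [[-> ->]|h2] := pselect (a = k /\ b = l).
    by left; rewrite Qkl; have := P0 k l; lra.
  have [[-> ->]|h3] := pselect (a = i /\ b = l).
    by left; rewrite Qil; lra.
  have [[-> ->]|h4] := pselect (a = k /\ b = j).
    by left; rewrite Qkj; lra.
  right; rewrite !mxE.
  have E c d : ~ (a = c /\ b = d) -> (a == c) && (b == d) = false.
    by move=> h; apply/negP => /andP[/eqP ? /eqP ?]; apply: h.
  by rewrite !E//; lra.
have sumD (w : 'I_n -> 'I_n -> R) :
    \sum_a \sum_b D a b * w a b = w i j + w k l - w i l - w k j.
  rewrite -(sum_delta_mx i j w) -(sum_delta_mx k l w) -(sum_delta_mx i l w).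
  rewrite -(sum_delta_mx k j w) -!(big_split, sumrB)/=; apply: eq_bigr => a _.
  rewrite -!(big_split, sumrB)/=; apply: eq_bigr => b _.
  by rewrite !mxE; lra.
have QT : transport_polytope p q Q.
  have rowD a : \sum_b D a b = 0.
    (* Pairing with the indicator of row [a] isolates the sum of that row. *)
    have := sumD (fun c _ => (c == a)%:R); rewrite addrAC addrK subrr => sum0.
    rewrite -[RHS]sum0 [RHS](bigD1 a)//= [X in _ = _ + X]big1 ?addr0.
      by apply: eq_bigr => b _; rewrite eqxx mulr1.
    by move=> c ca; rewrite big1// => b _; rewrite (negPf ca) mulr0.
  have colD b : \sum_a D a b = 0.
    have := sumD (fun _ d => (d == b)%:R); rewrite addrK subrr => sum0.
    rewrite -[RHS]sum0; apply: eq_bigr => a _.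
    rewrite (bigD1 b)//= eqxx mulr1 big1 ?addr0//.
    by move=> d db; rewrite (negPf db) mulr0.
  apply/transport_polytopeP; split=> [a b|a|b].
  - by case: (Q0 a b) => [/ltW//|->].
  - under eq_bigr do rewrite /Q mxE [X in _ + X]mxE.
    by rewrite big_split/= -mulr_sumr rowD mulr0 addr0.
  - under eq_bigr do rewrite /Q mxE [X in _ + X]mxE.
    by rewrite big_split/= -mulr_sumr colD mulr0 addr0.
have := Pmin _ QT; rewrite -subr_ge0 => hmin.
(* On the touched entries [w] is the gradient of the objective at [Q]; by convexity the change from
   [P] to [Q] is at most the pairing of [w] with [Q - P = t *: D]. *)
pose w a b := ln (Q a b) - ln (K a b) + 1.
have : 0 <= t * (w i j + w k l - w i l - w k j).
  apply: (le_trans hmin); rewrite -sumD mulr_sumr !sinkhorn_objectiveE -sumrB.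
  apply: ler_sum => a _; rewrite mulr_sumr -sumrB; apply: ler_sum => b _.
  have QD : Q a b = P a b + t * D a b by rewrite /Q mxE [X in _ + X]mxE.
  rewrite mulrA [t * D a b](_ : _ = Q a b - P a b); last by rewrite QD; lra.
  have [Qp|->] := Q0 a b; last by rewrite !subrr mul0r.
  have := xlnV_le_tangent (P0 a b) Qp; rewrite (xlnVE (ltW Qp)) /w; lra.
rewrite pmulr_rge0// /w Qij Qkl Qil Qkj => h.
have ij0 : 0 < P i j + t by rewrite ltr_wpDl.
have kl0 : 0 < P k l + t by rewrite ltr_wpDl.
have il1 : 0 < P i l - t by lra.
have kj1 : 0 < P k j - t by lra.
rewrite -ler_ln ?posrE ?mulr_gt0// !lnM ?posrE ?mulr_gt0//; lra.
Qed.

(** Swapping [j] and [l] reverses the exchange cycle and gives the opposite inequality. *)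
Lemma argmin_exchange p q K P i j k l : K \is a mxOver Num.pos ->
  is_argmin (transport_polytope p q) (sinkhorn_objective K) P ->
  K i j * K k l * (P i l * P k j) = K i l * K k j * (P i j * P k l).
Proof.
move=> K0 Pmin.
have [->|ik] := eqVneq i k; first by ring.
have [->|jl] := eqVneq j l; first by ring.
apply/eqP; rewrite eq_le (argmin_exchange_le K0 Pmin)//=.
have := @argmin_exchange_le p q K P i l k j K0 Pmin ik.
by rewrite eq_sym; apply.
Qed.

(** The exchange identity makes every 2x2 minor of the entrywise quotient [P / K] vanish, so this
    quotient has rank at most one. *)
Lemma argmin_scaling p q K P : K \is a mxOver Num.pos ->
  p \is a mxOver Num.pos -> q \is a mxOver Num.pos ->
  is_argmin (transport_polytope p q) (sinkhorn_objective K) P ->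
  is_scaling_of K P.
Proof.
move=> K0 /mxOverP p0 /mxOverP q0 Pmin.
have {}p0 i : 0 < p i ord0 by have := p0 i ord0.
have {}q0 i : 0 < q i ord0 by have := q0 i ord0.
have /transport_polytopeP[P0 Pp Pq] := Pmin.1.
have Kp a b : 0 < K a b by have /mxOverP/(_ a b) := K0.
have Pex (I : finType) (F : I -> R) : (forall i, 0 <= F i) -> 0 < \sum_i F i ->
    exists i, 0 < F i.
  move=> F0 /gt_eqF/negbT; rewrite psumr_neq0// => /hasP[i _ Fi].
  by exists i.
(* Positive marginals give some [P i l > 0] and [P k j > 0]; with [P i j = 0] the exchange identity
   would fail. *)
have Ppos i j : 0 < P i j.
  have [l il] : exists l, 0 < P i l by apply: Pex => //; rewrite Pp.
  have [k kj] : exists k, 0 < P k j by apply: Pex => //; rewrite Pq.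
  rewrite lt_def P0 andbT; apply/eqP => ij.
  have := argmin_exchange i j k l K0 Pmin.
  rewrite ij mul0r mulr0; apply/eqP; rewrite gt_eqF//.
  by rewrite !mulr_gt0.
have [z _|no] := pickP [pred i : 'I_n | true]; last first.
  exists 0, 0; split; last by apply/matrixP => i; have := no i.
    by apply/mxOverP => ? j; have := no j.
  by apply/mxOverP => ? j; have := no j.
(* The factors are column [z] and row [z] of the quotient [P / K], the latter divided by the pivot
   at [(z, z)]. *)
exists (\row_i (P i z / K i z)).
exists (\row_j (P z j * K z z / (K z j * P z z))); split.
- by apply/mxOverP => a b; rewrite mxE posrE divr_gt0.
- by apply/mxOverP => a b; rewrite mxE posrE divr_gt0// mulr_gt0.
apply/matrixP => i j; rewrite scalingE !mxE.
have := argmin_exchange i j z z K0 Pmin => e.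
have e' : P i j = K i j * K z z * (P i z * P z j) / (K i z * K z j * P z z).
  by rewrite e; field; rewrite !gt_eqF.
by rewrite e'; field; rewrite !gt_eqF.
Qed.

End SinkhornObjective.

(** * Existence of a minimizer, and minimality of the projection *)

Section Existence.
Variable R : realType.

(** On the negative axis [ln] is 0 by convention, so the function vanishes. At 0 it is squeezed by
    [2 * sqrt y], from [ln z < z] at [z = 1 / sqrt y]. *)
Lemma xlnV_continuous : continuous (@xlnV R).
Proof.
move=> x; case: (ltrgtP x 0) => [x0|x0|->].
- apply: (near_cst_continuous 0); near=> y.
  have y0 : y < 0 by near: y; exact: lt_nbhsl.
  by rewrite /xlnV ln0 ?mulr0// invr_le0 ltW.
- apply: cvgM; first exact: cvg_id.
  apply: continuous_comp; first by apply: inv_continuous; rewrite gt_eqF.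
  by apply: continuous_ln; rewrite invr_gt0.
- rewrite /continuous_at xlnV0.
  apply: (@squeeze_cvgr _ _ _ _ (fun=> 0) (fun y => 2 * Num.sqrt y)).
  + near=> y; have y1 : y < 1 by near: y; exact: lt_nbhsl.
    have [y0|y0] := leP y 0.
      by rewrite /xlnV ln0 ?invr_le0// mulr0 lexx mulr_ge0// sqrtr_ge0.
    rewrite xlnV_ge0 ?(ltW y0) ?(ltW y1)//=.
    have s0 : 0 < Num.sqrt y by rewrite sqrtr_gt0.
    have ys : y = Num.sqrt y * Num.sqrt y by rewrite -expr2 sqr_sqrtr// ltW.
    rewrite {1}ys /xlnV invfM lnM ?posrE ?invr_gt0//.
    have h : ln (Num.sqrt y)^-1 <= (Num.sqrt y)^-1.
      by rewrite ltW// ln_sublinear// invr_gt0.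
    have : y * ln (Num.sqrt y)^-1 <= Num.sqrt y.
      rewrite {1}ys -[leRHS]mulr1 -mulrA ler_pM2l//.
      by rewrite -(divff (lt0r_neq0 s0)) ler_pM2l.
    by rewrite -ys; lra.
  + exact: cvg_cst.
  + rewrite -[X in _ --> X](mulr0 2) -[X in 2 * X](@sqrtr0 R).
    by apply: cvgM; [exact: cvg_cst|exact: sqrt_continuous].
Unshelve. all: by end_near. Qed.

(* Matrices are flattened to row vectors, for which compactness of cubes is
   available. *)
Lemma sinkhorn_objective_argmin_exists n (p q : 'cV[R]_n) (K : 'M[R]_n) :
  simplex p -> simplex q ->
  exists P, is_argmin (transport_polytope p q) (sinkhorn_objective K) P.
Proof.
move=> /simplex_cvP[p0 p1] /simplex_cvP[q0 q1].
pose A := [set v : 'rV[R]_(n * n) | transport_polytope p q (vec_mx v)].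
have vE i j : continuous (fun v : 'rV[R]_(n * n) => (vec_mx v : 'M[R]_n) i j).
  move=> v; rewrite (_ : (fun _ => _) =
      (fun v : 'rV[R]_(n * n) => v ord0 (mxvec_index i j))).
    exact: coord_continuous.
  by apply/funext => w; rewrite mxE.
have contsum (I : finType) (f : I -> 'rV[R]_(n * n) -> R) :
    (forall i, continuous (f i)) -> continuous (fun v => \sum_i f i v).
  by move=> cf; apply: continuous_big => [|i _]; [exact: add_continuous|exact: cf].
have A0 : A !=set0.
  (* The product coupling of [p] and [q]. *)
  exists (mxvec (\matrix_(i, j) (p i ord0 * q j ord0))); rewrite /A/= mxvecK.
  apply/transport_polytopeP; split=> [i j|i|j].
  - by rewrite mxE mulr_ge0.
  - by under eq_bigr do rewrite mxE; rewrite -mulr_sumr q1 mulr1.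
  - by under eq_bigr do rewrite mxE; rewrite -mulr_suml p1 mul1r.
have Acl : closed A.
  have -> : A =
    \bigcap_(ij in [set: 'I_n * 'I_n])
      [set v | 0 <= (vec_mx v : 'M[R]_n) ij.1 ij.2] `&`
    (\bigcap_(i in [set: 'I_n])
      [set v | \sum_j (vec_mx v : 'M[R]_n) i j = p i ord0] `&`
     \bigcap_(j in [set: 'I_n])
      [set v | \sum_i (vec_mx v : 'M[R]_n) i j = q j ord0]).
    apply/seteqP; split=> v /=.
      move=> /transport_polytopeP[v0 vp vq]; split; first by move=> [i j] _; exact: v0.
      by split=> i _; [exact: vp|exact: vq].
    move=> [v0 [vp vq]]; apply/transport_polytopeP; split=> [i j|i|j].
    - exact: (v0 (i, j)).
    - exact: vp.
    - exact: vq.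
  apply: closedI; [|apply: closedI]; apply: closed_bigI => i _.
  - exact: (@preimage_closed _ _ _ _ (fun v _ => @vE i.1 i.2 v) (@closed_ge _ 0)).
  - exact: (@preimage_closed _ _ _ _ (fun v _ => contsum _ _ (vE i) v)
      (@closed_eq _ (p i ord0))).
  - exact: (@preimage_closed _ _ _ _ (fun v _ => contsum _ _ (vE^~ i) v)
      (@closed_eq _ (q i ord0))).
(* Each entry of a coupling is at most the total mass 1, so [A] lies in the unit cube. *)
have Aco : compact A.
  apply: subclosed_compact Acl (@rV_compact R _ (fun=> `[0, 1]%classic) _) _.
    by move=> _; exact: segment_compact.
  move=> v /transport_polytopeP[v0 vp vq] k.
  case/mxvec_indexP: k => i j; have := v0 i j; rewrite mxE => vij.
  rewrite /= in_itv/= vij -p1 (bigD1 i)//= -vp (bigD1 j)//= mxE -addrA lerDl.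
  by rewrite addr_ge0// sumr_ge0// => k _; rewrite -?vp ?sumr_ge0.
have cf : continuous (fun v : 'rV[R]_(n * n) => sinkhorn_objective K (vec_mx v)).
  under [X in continuous X]funext => v do rewrite sinkhorn_objectiveE.
  apply: (contsum _ _) => i; apply: (contsum _ _) => j v.
  have cM : {for v, continuous (fun v : 'rV[R]_(n * n) =>
      (vec_mx v : 'M[R]_n) i j * ln (K i j))}.
    exact: (continuousM (vE i j v) (@cst_continuous _ _ (ln (K i j)) v)).
  have cX : {for v, continuous (fun v : 'rV[R]_(n * n) =>
      xlnV ((vec_mx v : 'M[R]_n) i j))}.
    exact: (continuous_comp (vE i j v) (@xlnV_continuous _)).
  exact: (continuousB (continuousN cM) cX).
have [c /set_mem cA cmin] := EVT_min_rV A0 Aco (continuous_subspaceT cf).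
exists (vec_mx c); split=> // Q QT.
by rewrite -[Q]mxvecK; apply: cmin; rewrite inE /A/= mxvecK.
Qed.

(** An existing minimizer satisfies the defining predicate in either case, so [xget] returns a
    genuine projection; if that is given as a scaling, [scaling_argmin] applies. *)
Lemma sinkhorn_projection_argmin n (p q : 'cV[R]_n) (K : 'M[R]_n) :
  simplex p -> simplex q -> K \is a mxOver Num.pos ->
  is_argmin (transport_polytope p q) (sinkhorn_objective K) (sinkhorn_projection p q K).
Proof.
move=> hp hq K0; have [P Pmin] := sinkhorn_objective_argmin_exists K hp hq.
have : is_sinkhorn_projection p q K (sinkhorn_projection p q K).
  apply: (@xgetPex _ 0 [set P | is_sinkhorn_projection p q K P]).
  exists P; rewrite /= /is_sinkhorn_projection; case: ifPn => // /andP[p0 q0].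
  by split; [exact: Pmin.1|exact: argmin_scaling Pmin].
rewrite {1}/is_sinkhorn_projection; case: ifPn => // _ [PT PS].
exact: scaling_argmin.
Qed.

End Existence.

(** * Stability of the regularized cost and the final comparison *)

Lemma reg_costE (R : realType) (n : nat) (eta : R) (K C Q : 'M[R]_n) :
  (forall i j, C i j = - eta^-1 * ln (K i j)) ->
  reg_cost eta C Q = eta^-1 * sinkhorn_objective K Q.
Proof.
move=> hC; rewrite /reg_cost /sinkhorn_objective mulrBr; congr (_ - _).
rewrite /frob_inner mulr_sumr; apply: eq_bigr => i _.
by rewrite mulr_sumr; apply: eq_bigr => j _; rewrite hC !mxE; lra.
Qed.

Lemma reg_cost_dist (R : realType) (n : nat) (eta d : R) (C P Q : 'M[R]_n) :
  (2 <= n)%N -> 0 < eta -> simplex P -> simplex Q ->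
  \sum_i \sum_j `|P i j - Q i j| <= d -> d <= 1 ->
  reg_cost eta C P - reg_cost eta C Q
    <= d * mx_norm C + eta^-1 * d * ln (2 * n%:R / d).
Proof.
move=> n2 eta0 /simplexP[P0 P1] /simplexP[Q0 Q1] PQd d1.
have frob : frob_inner C P - frob_inner C Q <= d * mx_norm C.
  have C0 : 0 <= mx_norm C by rewrite mx_normrE; exact: bigmax_ge_id.
  apply: le_trans (ler_wpM2r C0 PQd).
  rewrite -sumrB mulr_suml; apply: ler_sum => i _.
  rewrite -sumrB mulr_suml; apply: ler_sum => j _.
  rewrite -mulrBr mulrC; apply: (le_trans (ler_norm _)).
  rewrite normrM ler_wpM2l// mx_normrE.
  exact: (le_bigmax _ (fun ij : 'I_n * 'I_n => `|C ij.1 ij.2|) (i, j)).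
(* Entropy enters the cost with a minus sign, hence the exchanged roles of [P] and [Q]. *)
have ent : entropy Q - entropy P <= d * ln (2 * n%:R / d).
  rewrite /entropy !pair_big/=.
  have := @dist_sum_xlnV R ('I_n * 'I_n)%type n (fun ij => Q ij.1 ij.2)
    (fun ij => P ij.1 ij.2) d n2.
  apply=> //; first by rewrite card_prod card_ord.
  - by rewrite -Q1 pair_big.
  - by rewrite -P1 pair_big.
  - apply: le_trans PQd; rewrite pair_big/=.
    by apply: ler_sum => ij _; rewrite distrC.
have e0 : 0 <= eta^-1 by rewrite invr_ge0 ltW.
have := ler_wpM2l e0 ent.
by rewrite /reg_cost mulrBr mulrA; lra.
Qed.

Lemma norm1N (R : realType) (n : nat) (v : 'cV[R]_n) : norm1 (- v) = norm1 v.
Proof. by apply: eq_bigr => i _; rewrite mxE normrN. Qed.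

Theorem proposition3 (R : realType) (n : nat) (hn : (2 <= n)%N)
    (eta : R) (heta : 0 < eta)
    (p q : 'cV[R]_n) (hp : simplex p) (hq : simplex q)
    (K : 'M[R]_n) (hK : K \is a mxOver Num.pos)
    (C : 'M[R]_n) (hC : forall i j, C i j = - eta^-1 * ln (K i j))
    (d1 d2 : 'rV[R]_n)
    (hd1 : d1 \is a mxOver Num.pos) (hd2 : d2 \is a mxOver Num.pos)
    (P : 'M[R]_n) (hPdef : P = diag_mx d1 *m K *m diag_mx d2)
    (hP : simplex P)
    (delta : R)
    (hdelta : delta = norm1 (p - P *m const_mx 1)
                      + norm1 (q - P^T *m const_mx 1))
    (hdelta1 : delta <= 1) :
  `|reg_cost eta C (sinkhorn_projection p q K) - reg_cost eta C P|
    <= delta * mx_norm C + eta^-1 * delta * ln (2 * n%:R / delta).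
Proof.
set S := sinkhorn_projection p q K.
have Smin : is_argmin (transport_polytope p q) (sinkhorn_objective K) S.
  exact: sinkhorn_projection_argmin.
pose p' := P *m (const_mx 1 : 'cV_n); pose q' := P^T *m (const_mx 1 : 'cV_n).
have [P0 P1] := (simplexP P).1 hP.
have PT : transport_polytope p' q' P by case: hP.
have Pmin : is_argmin (transport_polytope p' q') (sinkhorn_objective K) P.
  by apply: scaling_argmin => //; exists d1, d2.
have hp' : simplex p'.
  apply/simplex_cvP; split=> [i|]; first by rewrite mulmx_const1E sumr_ge0.
  by rewrite -[RHS]P1; apply: eq_bigr => i _; rewrite mulmx_const1E.
have hq' : simplex q'.
  have trE i j : P^T i j = P j i by rewrite mxE.
  apply/simplex_cvP; split=> [i|].
    by rewrite mulmx_const1E sumr_ge0// => j _; rewrite trE.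
  rewrite -[RHS]P1 exchange_big; apply: eq_bigr => i _.
  by rewrite mulmx_const1E; apply: eq_bigr => j _; rewrite trE.
have delta' : delta = norm1 (p' - p) + norm1 (q' - q).
  by rewrite hdelta -norm1N -[X in _ + X]norm1N !opprB.
have [P2 P2T] := transport_polytope_change hp' hq' hp hq PT.
have [S2 S2T] := transport_polytope_change hp hq hp' hq' Smin.1.
rewrite -delta' -hdelta => S2S P2P.
have hS := transport_polytope_simplex hp Smin.1.
have hS2 := transport_polytope_simplex hp' S2T.
have hP2 := transport_polytope_simplex hp P2T.
have e0 : 0 <= eta^-1 by rewrite invr_ge0 ltW.
have opt T X Y : is_argmin T (sinkhorn_objective K) X -> T Y ->
    reg_cost eta C X <= reg_cost eta C Y.
  by move=> [_ Xmin] TY; rewrite !(reg_costE _ hC) ler_wpM2l// Xmin.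
(* One half compares [P] with [S2], the copy of [S] having the marginals of [P]; the other compares
   [S] with [P2]. *)
rewrite ler_norml lerNl opprB; apply/andP; split.
  apply: le_trans (reg_cost_dist C hn heta hS2 hS S2S hdelta1).
  by rewrite lerD2r; exact: opt Pmin S2T.
apply: le_trans (reg_cost_dist C hn heta hP2 hP P2P hdelta1).
by rewrite lerD2r; exact: opt Smin P2T.
Qed.
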